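(* Let $0\le L<U<\infty$, $\beta_1\ge 0$, $\beta_2>0$, $\beta_3>0$, let $n_1,n_2,n_3$ be positive integers, and write $\mu(x)=\beta_1+\beta_2x^{\beta_3}$ and $\mu_i=\mu(x_i)$. Let $g$ be a canonical link function as described in the context, and for stimuli $L\le x_1<x_2<x_3\le U$ let $$|I_{3\times3}(\boldsymbol\beta)|=\beta_2^2\left[(x_1x_2)^{\beta_3}\log\left(\tfrac{x_2}{x_1}\right)-(x_1x_3)^{\beta_3}\log\left(\tfrac{x_3}{x_1}\right)+(x_2x_3)^{\beta_3}\log\left(\tfrac{x_3}{x_2}\right)\right]^2\prod_{i=1}^3\left[n_i\,g'(\mu_i)\right].$$ Suppose that $g'(\mu)\ge 0$, $g''(\mu)\le 0$ and $g''(\mu)\mu+2g'(\mu)\ge 0$ for all attainable means $\mu\in\{\mu(x):x\in[L,U]\}$. Then, for any given $x_1,x_2$ with $L\le x_1<x_2<U$, the optimal stimulus $x_3^{\mathrm{opt}}$, i.e. the value of $x_3\in(x_2,U]$ that maximizes $|I_{3\times3}(\boldsymbol\beta)|$, is the largest possible value: $x_3^{\mathrm{opt}}=U$.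
   Context: Setting: independent responses $y_{ij}$, $j=1,\dots,n_i$, at stimulus $x_i\ge 0$, $i=1,2,3$, have density $\exp\{[y\theta_i-b(\theta_i)]/a(\phi)+c(y,\phi)\}$ with $b$ at least twice differentiable, so that $\mathbb{E}(y_{ij}|x_i)=\mu_i=b'(\theta_i)$ and $\mathrm{Var}(y_{ij}|x_i)=b''(\theta_i)a(\phi)$. The mean is the Mitscherlich function $\mu_i=\beta_1+\beta_2x_i^{\beta_3}$, with $\boldsymbol\beta=(\beta_1,\beta_2,\beta_3)^T$. The canonical link $g$ satisfies $\theta_i=g(\mu_i)$, i.e. $g$ is the inverse of $b'$ (hence $g'(\mu)\,b''(g(\mu))=1$). It is a twice differentiable real function on an open interval containing all attainable means $\mu(x)=\beta_1+\beta_2x^{\beta_3}$, $x\in[L,U]$. $I_{3\times3}(\boldsymbol\beta)$ is the $3\times 3$ matrix with entries $\sum_{i=1}^3 n_i g'(\mu_i)\frac{\partial\mu_i}{\partial\beta_r}\frac{\partial\mu_i}{\partial\beta_s}$ (the Fisher information for $\boldsymbol\beta$ up to the factor $1/a(\phi)$); its determinant is the expression displayed in the claim. Convention: when $x_1=0$, terms of the form $x_1^{\beta_3}\log(c/x_1)$ with $c>0$ are read as their limit $0$. *)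

(* Defs.v *)
From HB Require Import structures.
From mathcomp Require Import all_boot all_order all_algebra.
From mathcomp Require Import all_classical all_reals all_analysis.
Set Implicit Arguments.
Unset Strict Implicit.
Unset Printing Implicit Defensive.
Import Order.TTheory GRing.Theory Num.Theory.
Import numFieldNormedType.Exports.
Local Open Scope ring_scope.
Local Open Scope classical_set_scope.

Definition twice_derivable_on (R : realType) (A : set R) (f : R -> R) : Prop :=
  forall x, A x -> derivable f x 1 /\ derivable (derive1 f) x 1.

(* [b] is the cumulant function of the exponential family on the natural
   parameter space [Theta], so that [derive1 b theta] is the mean response.
   [M] is an interval of means on which the link [g] inverts [derive1 b]; it
   may be smaller than the range of [derive1 b]. *)
Definition canonical_link (R : realType)
    (Theta : set R) (b : R -> R) (M : set R) (g : R -> R) : Prop :=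
  [/\ [/\ open Theta, is_interval Theta & twice_derivable_on Theta b],
      [/\ open M, is_interval M & twice_derivable_on M g],
      forall mu, M mu -> Theta (g mu) /\ derive1 b (g mu) = mu &
      forall theta, Theta theta -> M (derive1 b theta) ->
        g (derive1 b theta) = theta].

(* The parameter (beta_1, beta_2, beta_3) is a row vector with indices 0, 1, 2.
   Since [0 `^ beta_3 = 0] for beta_3 != 0 and [ln] is total, a term
   [0 `^ beta_3 * ln _] is 0, the limit of x ^ beta_3 * log (c / x) at 0+
   for beta_3 > 0. *)
Definition mitscherlich (R : realType) (beta : 'rV[R]_3) (x : R) : R :=
  beta 0 0 + beta 0 1 * x `^ beta 0 2.

Definition dmean (R : realType) (beta : 'rV[R]_3) (x : R) (r : 'I_3) : R :=
  'D_(delta_mx 0 r) (fun beta' : 'rV[R]_3 => mitscherlich beta' x) beta.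

(* Fisher information for beta, up to the factor 1 / a(phi). *)
Definition fisher_info (R : realType) (g : R -> R) (n : 'I_3 -> nat)
    (beta : 'rV[R]_3) (x : 3.-tuple R) : 'M[R]_3 :=
  \matrix_(r, s) \sum_(i < 3)
    (n i)%:R * derive1 g (mitscherlich beta (tnth x i)) *
    dmean beta (tnth x i) r * dmean beta (tnth x i) s.

Definition argmax (R : realType) (A : set R) (f : R -> R) : set R :=
  [set x | A x /\ forall y, A y -> f y <= f x].

(* Main.v *)
Require Import Defs.
From HB Require Import structures.
From mathcomp Require Import all_boot all_order all_algebra.
From mathcomp Require Import all_classical all_reals all_analysis.
From mathcomp Require Import ring.

(** With [t_i = x_i ^ beta_3], the information matrix is [J^T D J], where
    the rows of [J] are the gradients [(1, t_i, beta_2 * t_i * ln x_i)] and [D]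
    is diagonal with entries [n_i * g'(mu_i)].  Hence its determinant is
    [det J ^ 2 * \prod_i n_i * g'(mu_i)], which is the announced expression
    ([det_fisher_info]).

    Since [beta_3 * ln x_i = ln t_i], the factor [det J] is a constant times
    [d t_3], where [d t] is the determinant of the rows [(1, t_i, t_i ln t_i)]
    with [t] in place of [t_3] ([xlnx_det]).  Up to a positive constant, the
    function to maximize is therefore [d t ^ 2 * g'(mu)], with
    [mu = beta_1 + beta_2 * t]: here [d] grows with [t] whereas [g'] may
    decrease.  The two effects are separated by the factorization
      [d t ^ 2 * g'(mu) = (d t / t * (t / mu)) ^ 2 * (mu ^ 2 * g'(mu))].
    - [d t / t] is positive and strictly increasing on [t > t_2], by the
      inequality [ln u < u - 1] ([xlnx_det_div_increasing]);
    - [t / mu] is nondecreasing because [beta_1 >= 0];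
    - [mu ^ 2 * g'(mu)] is nondecreasing, its derivative being
      [mu * (g''(mu) * mu + 2 * g'(mu))], which the hypothesis makes
      nonnegative ([sqr_mul_derive1_le]).
    The product is strictly increasing as soon as [g' > 0], which holds because
    [g] inverts [b'] and so has a nonvanishing derivative
    ([canonical_link_derive_neq0]).  So [U] is the unique maximizer. *)

Set Implicit Arguments.
Unset Strict Implicit.
Unset Printing Implicit Defensive.
Import Order.TTheory GRing.Theory Num.Theory.
Import numFieldNormedType.Exports.
Local Open Scope ring_scope.
Local Open Scope classical_set_scope.

(** * Inequalities for the determinant with rows (1, u, u ln u) *)

Lemma ln_lt_subr1 (R : realType) (x : R) : 0 < x -> x != 1 -> ln x < x - 1.
Proof.
move=> x0 x1; rewrite ltrBrDl -[ltRHS]lnK ?posrE// expR_gt1Dx//.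
by rewrite ln_eq0.
Qed.

(** The difference of the two sides is the slope of [xlnx_det p q], defined
    below, at its zero [q]. *)
Lemma mulr_lnB_lt (R : realType) (p q : R) :
  0 <= p -> p < q -> p * (ln q - ln p) < q - p.
Proof.
rewrite le_eqVlt => /predU1P[<-|p0] pq; first by rewrite mul0r subr0.
have q0 : 0 < q by exact: lt_trans pq.
rewrite -ln_div ?posrE// mulrC -ltr_pdivlMr// mulrBl divff ?gt_eqF//.
by apply: ln_lt_subr1; rewrite ?divr_gt0// gt_eqF// ltr_pdivlMr ?mul1r.
Qed.

(** The determinant of the matrix with rows [(1, u, u * ln u)] for
    [u = p, q, t]. *)
Definition xlnx_det (R : realType) (p q t : R) : R :=
  p * q * (ln q - ln p) - p * t * (ln t - ln p) + q * t * (ln t - ln q).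

(** Dividing by [t] leaves, as functions of [t], only the logarithm
    [(q - p) * ln t] and the hyperbola [p * q * (ln q - ln p) / t].  Between [s]
    and [t] the logarithm gains at least [(q - p) * (t - s) / t] and the
    hyperbola loses [p * q * (ln q - ln p) * (t - s) / (s * t)], which is less
    since [p * (ln q - ln p) < q - p] and [q <= s]. *)
Lemma xlnx_det_div_increasing (R : realType) (p q s t : R) :
  0 <= p -> p < q -> q <= s -> s < t ->
  xlnx_det p q s / s < xlnx_det p q t / t.
Proof.
move=> p0 pq qs st.
have q0 : 0 < q by exact: le_lt_trans pq.
have s0 : 0 < s by exact: lt_le_trans qs.
have t0 : 0 < t by exact: lt_trans st.
(* The bound ln u < u - 1 at u = s / t, multiplied by s. *)
have hln : s * (ln t - ln s) > s * (t - s) / t.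
  rewrite -subr_gt0.
  have : ln (s / t) < s / t - 1.
    apply: ln_lt_subr1; rewrite ?divr_gt0//.
    by rewrite lt_eqF// ltr_pdivrMr ?mul1r.
  rewrite ln_div ?posrE// => h.
  have -> : s * (ln t - ln s) - s * (t - s) / t =
     s * ((s / t - 1) - (ln s - ln t)) by field; rewrite gt_eqF.
  by rewrite mulr_gt0// subr_gt0.
have hpq : p * q * (ln q - ln p) < s * (q - p).
  have h := mulr_lnB_lt p0 pq.
  apply: (@lt_le_trans _ _ (q * (q - p))).
    by rewrite mulrAC mulrC ltr_pM2l.
  by rewrite ler_pM2r// subr_gt0.
have -> : xlnx_det p q t / t = xlnx_det p q s / s +
   ((q - p) * (s * (ln t - ln s)) -
    p * q * (ln q - ln p) * ((t - s) / t)) / s.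
  by rewrite /xlnx_det; field; rewrite !gt_eqF.
rewrite ltrDl divr_gt0// subr_gt0.
have hts : 0 < (t - s) / t by rewrite divr_gt0// subr_gt0.
apply: (@lt_trans _ _ ((s * (q - p)) * ((t - s) / t))).
  by rewrite ltr_pM2r.
have -> : s * (q - p) * ((t - s) / t) = (q - p) * (s * (t - s) / t) by ring.
by rewrite ltr_pM2l// subr_gt0.
Qed.

Lemma xlnx_det_gt0 (R : realType) (p q t : R) :
  0 <= p -> p < q -> q < t -> 0 < xlnx_det p q t.
Proof.
move=> p0 pq qt; have q0 := le_lt_trans p0 pq.
have t0 : 0 < t by exact: lt_trans qt.
have := xlnx_det_div_increasing p0 pq (lexx q) qt.
have -> : xlnx_det p q q = 0 by rewrite /xlnx_det; ring.
by rewrite mul0r pmulr_lgt0 ?invr_gt0.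
Qed.

(** * Determinants of weighted Gram matrices *)

Lemma prod_ord3 (R : comNzRingType) (F : 'I_3 -> R) :
  \prod_(i < 3) F i = F 0 * F 1 * F 2.
Proof.
rewrite !big_ord_recl big_ord0 mulr1 mulrA.
by congr (_ * F _ * F _); apply/val_inj.
Qed.

Lemma det_mx33 (R : comNzRingType) (A : 'M[R]_3) :
  let a i j := A (inord i) (inord j) in
  \det A = a 0%N 0%N * (a 1%N 1%N * a 2%N 2%N - a 1%N 2%N * a 2%N 1%N)
         - a 0%N 1%N * (a 1%N 0%N * a 2%N 2%N - a 1%N 2%N * a 2%N 0%N)
         + a 0%N 2%N * (a 1%N 0%N * a 2%N 1%N - a 1%N 1%N * a 2%N 0%N).
Proof.
move=> a.
(* Over natural indices, the ordinals created by the expansion compute. *)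
have aE (i j : 'I_3) : A i j = a i j by rewrite /a !inord_val.
rewrite (expand_det_row _ ord0) !big_ord_recl big_ord0 /cofactor.
rewrite !(expand_det_row _ ord0) !big_ord_recl !big_ord0 /cofactor !det_mx11.
rewrite !mxE !aE /= /bump /=.
ring.
Qed.

Lemma det_gram_weighted (R : comNzRingType) (m : nat) (J : 'M[R]_m)
    (w : 'I_m -> R) :
  \det (\matrix_(r, s) \sum_i w i * J i r * J i s) = \det J ^+ 2 * \prod_i w i.
Proof.
have -> : \matrix_(r, s) \sum_i w i * J i r * J i s =
    J^T *m diag_mx (\row_i w i) *m J.
  apply/matrixP => r s; rewrite !mxE; apply: eq_bigr => i _.
  by rewrite mul_mx_diag !mxE [w i * _]mulrC.
rewrite !det_mulmx det_tr det_diag.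
under [X in _ * X * _]eq_bigr do rewrite mxE.
by rewrite expr2; ring.
Qed.

(** * Gradient of the mean and the information determinant *)

(** Reduces partial derivatives to derivatives of functions of one real
    variable. *)
Lemma derive_along (R : realType) (V : normedModType R) (f : V -> R) (a v : V) :
  'D_v f a = (fun t : R => f (t *: v + a))^`() 0.
Proof.
suff E : (fun h : R => h^-1 *: ((f \o shift a) (h *: v) - f a)) =
    (fun h => h^-1 *: (f ((h + 0) *: v + a) - f (0 *: v + a))).
  by rewrite /derive E.
by apply/funext => h /=; rewrite addr0 scale0r add0r.
Qed.

Lemma dmean0 (R : realType) (beta : 'rV[R]_3) (x : R) : dmean beta x 0 = 1.
Proof.
rewrite /dmean derive_along /mitscherlich.
have -> : (fun t : R => (t *: delta_mx 0 0 + beta) 0 0 +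
   (t *: delta_mx 0 0 + beta) 0 1 * x `^ (t *: delta_mx 0 0 + beta) 0 2) =
   (fun t => t + mitscherlich beta x).
  by apply/funext => t; rewrite !mxE /= mulr1 !mulr0 !add0r addrA.
by rewrite derive1E deriveD// derive_id derive_cst addr0.
Qed.

Lemma dmean1 (R : realType) (beta : 'rV[R]_3) (x : R) :
  dmean beta x 1 = x `^ beta 0 2.
Proof.
rewrite /dmean derive_along /mitscherlich.
have -> : (fun t : R => (t *: delta_mx 0 1 + beta) 0 0 +
   (t *: delta_mx 0 1 + beta) 0 1 * x `^ (t *: delta_mx 0 1 + beta) 0 2) =
   (fun t => x `^ beta 0 2 * t + mitscherlich beta x).
  apply/funext => t; rewrite !mxE /= mulr1 !mulr0 !add0r /mitscherlich; ring.
rewrite derive1E deriveD// derive_cst addr0 deriveM// derive_id derive_cst.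
by rewrite scaler0 addr0 scaler1.
Qed.

(** For [x = 0] the power vanishes at every positive exponent, hence is locally
    constant, and the formula gives [0] because [0 `^ y = 0]. *)
Lemma is_derive_powR_exponent (R : realType) (x y : R) : 0 <= x -> 0 < y ->
  is_derive y 1 (fun z => x `^ z) (x `^ y * ln x).
Proof.
rewrite le_eqVlt => /predU1P[<-|x0] y0.
  apply: (@near_eq_is_derive _ _ _ (cst 0)); last first.
    by rewrite powR0 ?gt_eqF// mul0r; exact: is_derive_cst.
  near=> z; rewrite /= powR0// gt_eqF//; near: z.
  exact: lt_nbhsr.
have -> : (fun z => x `^ z) = expR \o (fun z => z * ln x).
  by apply/funext => z; rewrite /powR gt_eqF.
rewrite /powR gt_eqF//.
apply: is_derive_eq.
by rewrite /= !scaler0 ?scaler1 ?addr0 add0r.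
Unshelve. all: by end_near. Qed.

Lemma dmean2 (R : realType) (beta : 'rV[R]_3) (x : R) :
  0 <= x -> 0 < beta 0 2 -> dmean beta x 2 = beta 0 1 * (x `^ beta 0 2 * ln x).
Proof.
move=> x0 b0.
rewrite /dmean derive_along /mitscherlich.
have -> : (fun t : R => (t *: delta_mx 0 2 + beta) 0 0 +
   (t *: delta_mx 0 2 + beta) 0 1 * x `^ (t *: delta_mx 0 2 + beta) 0 2) =
   (fun t => beta 0 0 + beta 0 1 * x `^ (t + beta 0 2)).
  by apply/funext => t; rewrite !mxE /= mulr1 !mulr0 !add0r.
rewrite derive1E.
have dpow : is_derive (0 + beta 0 2) 1 (fun z => x `^ z)
    (x `^ beta 0 2 * ln x).
  by rewrite add0r; exact: is_derive_powR_exponent.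
have dshift : is_derive (0 : R) 1 (fun t => t + beta 0 2) 1.
  by apply: is_derive_eq; rewrite addr0.
have dcomp := @is_derive1_comp _ _ _ 0 _ _ dpow dshift.
have dline : is_derive (0 : R) 1
    (fun t => beta 0 0 + beta 0 1 * x `^ (t + beta 0 2))
    (beta 0 1 * (x `^ beta 0 2 * ln x)).
  apply: is_derive_eq.
  by rewrite /= add0r mulr1 mul1r.
exact: derive_val.
Qed.

Lemma det_fisher_info (R : realType) (g : R -> R) (n : 'I_3 -> nat)
    (beta : 'rV[R]_3) (x : 3.-tuple R) :
  (forall i, 0 <= tnth x i) -> 0 < beta 0 2 ->
  let p i := tnth x i `^ beta 0 2 in
  let l i := ln (tnth x i) in
  \det (fisher_info g n beta x) =
  beta 0 1 ^+ 2 *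
  (p 0 * p 1 * (l 1 - l 0) - p 0 * p 2 * (l 2 - l 0)
   + p 1 * p 2 * (l 2 - l 1)) ^+ 2 *
  \prod_(i < 3) ((n i)%:R * derive1 g (mitscherlich beta (tnth x i))).
Proof.
move=> x0 b0 p l.
pose J : 'M[R]_3 := \matrix_(i, r) dmean beta (tnth x i) r.
have -> : fisher_info g n beta x = \matrix_(r, s) \sum_i
    ((n i)%:R * derive1 g (mitscherlich beta (tnth x i))) * J i r * J i s.
  by apply/matrixP => r s; rewrite !mxE; apply: eq_bigr => i _; rewrite !mxE.
rewrite det_gram_weighted; congr (_ * _).
have inord3 : (inord 0 = 0 :> 'I_3) * (inord 1 = 1 :> 'I_3) *
    (inord 2 = 2 :> 'I_3).
  by do !split; apply/val_inj; rewrite /= inordK.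
rewrite det_mx33 /= !mxE !inord3 !dmean0 !dmean1 !dmean2// -/(p _) -/(l _).
rewrite -exprMn; congr (_ ^+ 2).
rewrite /p /l; ring.
Qed.

(** For [x = 0] both sides vanish with the power of [x], in accordance with the
    limit [0] of [x `^ b * ln (c / x)] at [0]. *)
Lemma powR_ln_ratio (R : realType) (b x y : R) : 0 < b -> 0 <= x -> 0 < y ->
  (x * y) `^ b * ln (y / x) = x `^ b * y `^ b * (ln y - ln x).
Proof.
move=> b0; rewrite le_eqVlt => /predU1P[<-|x0] y0.
  by rewrite mul0r powR0 ?gt_eqF// !mul0r.
by rewrite powRM ?ltW// ln_div ?posrE.
Qed.

(** * The link function along the attainable means *)

(** The chain rule applied to [b' (g mu) = mu] makes [g' mu] a factor of
    [1]. *)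
Lemma canonical_link_derive_neq0 (R : realType) (Theta : set R) (b : R -> R)
    (M : set R) (g : R -> R) (mu : R) :
  canonical_link Theta b M g -> M mu -> derive1 g mu != 0.
Proof.
move=> [[_ _ dbT] [oM _ dgM] gM _] Mmu; apply/eqP => g0.
have [dg _] := dgM _ Mmu.
have [Tgmu _] := gM _ Mmu.
have [_ db] := dbT _ Tgmu.
have bgE : \near mu, (derive1 b \o g) mu = id mu.
  near=> m => /=.
  suff /gM[] : M m by [].
  by near: m; exact: open_nbhs_nbhs.
have := derive1_comp dg db; rewrite g0 mulr0 derive1E.
by rewrite (near_eq_derive _ bgE) derive_id => /eqP; rewrite oner_eq0.
Unshelve. all: by end_near. Qed.

Lemma mitscherlich_lt (R : realType) (beta : 'rV[R]_3) (x y : R) :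
  0 < beta 0 1 -> 0 < beta 0 2 -> 0 <= x -> x < y ->
  mitscherlich beta x < mitscherlich beta y.
Proof.
move=> b1 b2 x0 xy; rewrite /mitscherlich ltrD2l ltr_pM2l//.
rewrite gt0_ltr_powR ?nnegrE//.
by rewrite (le_trans x0)// ltW.
Qed.

(** Hypotheses on [g] are given at the means of stimuli only; this transfers
    them to whole intervals of means, as the mean value theorem requires. *)
Lemma mitscherlich_surj (R : realType) (beta : 'rV[R]_3) (x y m : R) :
  0 < beta 0 1 -> 0 < beta 0 2 -> 0 <= x -> x <= y ->
  mitscherlich beta x <= m <= mitscherlich beta y ->
  exists2 z, x <= z <= y & mitscherlich beta z = m.
Proof.
move=> b1 b2 x0 xy /andP[xm my].
have y0 := le_trans x0 xy.
pose z := ((m - beta 0 0) / beta 0 1) `^ (beta 0 2)^-1.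
have z0 : 0 <= z by exact: powR_ge0.
have zm : mitscherlich beta z = m.
  rewrite /mitscherlich /z -powRrM mulVf ?gt_eqF// powRr1.
    by field; rewrite gt_eqF.
  rewrite divr_ge0 ?(ltW b1)// subr_ge0 (le_trans _ xm)// /mitscherlich.
  by rewrite lerDl mulr_ge0 ?(ltW b1)// powR_ge0.
exists z => //; rewrite !leNgt; apply/andP; split; apply/negP.
  by move=> /(mitscherlich_lt b1 b2 z0); rewrite zm ltNge xm.
by move=> /(mitscherlich_lt b1 b2 y0); rewrite zm ltNge my.
Qed.

(** The derivative of [m ^+ 2 * g' m] is [m * (g'' m * m + 2 * g' m)]. *)
Lemma sqr_mul_derive1_le (R : realType) (M : set R) (g : R -> R) (a c : R) :
  twice_derivable_on M g -> a <= c -> (forall m, a <= m <= c -> M m) ->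
  0 <= a ->
  (forall m, a <= m <= c -> 0 <= derive1n 2 g m * m + 2 * derive1 g m) ->
  a ^+ 2 * derive1 g a <= c ^+ 2 * derive1 g c.
Proof.
move=> dg ac acM a0 hg.
pose F (m : R) : R := m ^+ 2 * derive1 g m.
have dF m : a <= m <= c ->
    is_derive m 1 F (m * (derive1n 2 g m * m + 2 * derive1 g m)).
  move=> /acM/dg[_ dg2].
  have dg2' : is_derive m 1 (derive1 g) (derive1n 2 g m).
    apply: DeriveDef; first exact: dg2.
    by rewrite derive1nS derive1n1 -derive1E.
  apply: is_derive_eq; rewrite /= /GRing.scale /=; ring.
have inac m : a < m < c -> a <= m <= c by move=> /andP[/ltW -> /ltW ->].
apply: (@ger0_derive1_le_cc R F a c); last 3 first.
- by rewrite in_itv/= lexx ac.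
- by rewrite in_itv/= lexx ac.
- exact: ac.
- by move=> m; rewrite in_itv/= => /inac/dF[].
- move=> m; rewrite in_itv/= => /inac mac; rewrite derive1E.
  have [_ ->] := dF _ mac.
  by rewrite mulr_ge0 ?hg// (le_trans a0)//; case/andP: mac.
- by apply: derivable_within_continuous => m; rewrite in_itv/= => /dF[].
Qed.

(** * The optimal third stimulus *)

(** The heart of the argument: the growth of the squared determinant outweighs
    the decay of [g'], by the factorization of [regroup] below, in which [r] is
    the power [t] and [n] the mean. *)
Lemma sqr_xlnx_det_mul_derive1_lt (R : realType) (beta : 'rV[R]_3)
    (M : set R) (g : R -> R) (p q x y : R) :
  0 <= beta 0 0 -> 0 < beta 0 1 -> 0 < beta 0 2 ->
  twice_derivable_on M g ->
  (forall z, x <= z <= y -> M (mitscherlich beta z)) ->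
  (forall z, x <= z <= y ->
     0 <= derive1n 2 g (mitscherlich beta z) * mitscherlich beta z
          + 2 * derive1 g (mitscherlich beta z)) ->
  0 < derive1 g (mitscherlich beta x) ->
  0 <= p -> p < q -> q < x `^ beta 0 2 -> 0 < x -> x < y ->
  xlnx_det p q (x `^ beta 0 2) ^+ 2 * derive1 g (mitscherlich beta x) <
  xlnx_det p q (y `^ beta 0 2) ^+ 2 * derive1 g (mitscherlich beta y).
Proof.
move=> b0 b1 b2 dg xyM xyg g'x p0 pq qx x0 xy.
have y0 : 0 < y by exact: lt_trans xy.
have mu_gt0 z : 0 < z -> 0 < mitscherlich beta z.
  by move=> z0; rewrite ltr_wpDl// mulr_gt0// powR_gt0.
have txy : x `^ beta 0 2 < y `^ beta 0 2.
  by rewrite gt0_ltr_powR ?nnegrE// ltW.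
have tx0 : 0 < x `^ beta 0 2 by exact: powR_gt0.
have ty0 : 0 < y `^ beta 0 2 by exact: powR_gt0.
have mux0 := mu_gt0 _ x0; have muy0 := mu_gt0 _ y0.
have gmono : mitscherlich beta x ^+ 2 * derive1 g (mitscherlich beta x) <=
             mitscherlich beta y ^+ 2 * derive1 g (mitscherlich beta y).
  have attained m : mitscherlich beta x <= m <= mitscherlich beta y ->
      exists2 z, x <= z <= y & mitscherlich beta z = m.
    by apply: mitscherlich_surj => //; exact: ltW.
  apply: (sqr_mul_derive1_le dg); last 2 first.
  - exact: ltW.
  - by move=> m /attained[z xzy <-]; exact: xyg.
  - by apply: ltW; apply: mitscherlich_lt => //; exact: ltW.
  - by move=> m /attained[z xzy <-]; exact: xyM.
have tmu : x `^ beta 0 2 / mitscherlich beta x <=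
           y `^ beta 0 2 / mitscherlich beta y.
  rewrite ler_pdivrMr// mulrAC ler_pdivlMr// -subr_ge0 /mitscherlich.
  set s := x `^ _; set t := y `^ _.
  have -> : t * (beta 0 0 + beta 0 1 * s) - s * (beta 0 0 + beta 0 1 * t) =
      beta 0 0 * (t - s) by ring.
  by rewrite mulr_ge0// subr_ge0 ltW.
have dlt := xlnx_det_div_increasing p0 pq (ltW qx) txy.
have d0 : 0 < xlnx_det p q (x `^ beta 0 2) / x `^ beta 0 2.
  by rewrite divr_gt0// xlnx_det_gt0.
(* What remains is real arithmetic, so every mean, power, derivative and
   determinant becomes a variable. *)
move: (mitscherlich beta x) (mitscherlich beta y) mux0 muy0 g'x gmono tmu.
move=> m m' m0 m'0; move: (derive1 g m) (derive1 g m') => w w' w0 gmono.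
move: (x `^ _) (y `^ _) tx0 ty0 dlt d0 {txy qx} => s t s0 t0.
move: (xlnx_det p q s) (xlnx_det p q t) => d d' dlt d0 tmu.
have d'0 := lt_trans d0 dlt.
have regroup (e r n v : R) : 0 < r -> 0 < n ->
    e ^+ 2 * v = (e / r * (r / n)) ^+ 2 * (n ^+ 2 * v).
  by move=> r0 n0; field; rewrite !gt_eqF.
have u0 : 0 < d / s * (s / m) by rewrite mulr_gt0// divr_gt0.
have ult : d / s * (s / m) < d' / t * (t / m').
  apply: (@lt_le_trans _ _ (d' / t * (s / m))).
    by rewrite ltr_pM2r// divr_gt0.
  by rewrite ler_pM2l.
rewrite (regroup d s m)// (regroup d' t m')//.
apply: lt_le_trans (ler_wpM2l (exprn_ge0 2 (ltW (lt_trans u0 ult))) gmono).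
rewrite ltr_pM2r; first by rewrite ltrXn2r// ltW.
by rewrite mulr_gt0// exprn_gt0.
Qed.

Lemma argmax_right_endpoint (R : realType) (a u : R) (f : R -> R) :
  a < u -> (forall x, a < x -> x < u -> f x < f u) ->
  argmax [set x | a < x <= u] f = [set u].
Proof.
move=> au flt; have au' : a < u <= u by rewrite au lexx.
apply/seteqP; split=> [x [/andP[ax xu] xmax]|_ ->].
  apply/eqP; rewrite eq_le xu leNgt; apply/negP => /(flt _ ax).
  by rewrite ltNge (xmax _ au').
split=> // y /andP[ay]; rewrite le_eqVlt => /predU1P[->//|yu].
exact/ltW/flt.
Qed.

Theorem theorem2 (R : realType) (L U : R) (beta : 'rV[R]_3) (n : 'I_3 -> nat)
    (Theta : set R) (b : R -> R) (M : set R) (g : R -> R)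
    (hL : 0 <= L) (hLU : L < U)
    (hbeta1 : 0 <= beta 0 0) (hbeta2 : 0 < beta 0 1) (hbeta3 : 0 < beta 0 2)
    (hn : forall i, (0 < n i)%N)
    (hlink : canonical_link Theta b M g)
    (hM : forall x : R, L <= x <= U -> M (mitscherlich beta x))
    (hg1 : forall x : R, L <= x <= U -> 0 <= derive1 g (mitscherlich beta x))
    (hg2 : forall x : R, L <= x <= U -> derive1n 2 g (mitscherlich beta x) <= 0)
    (hg3 : forall x : R, L <= x <= U ->
       0 <= derive1n 2 g (mitscherlich beta x) * mitscherlich beta x
            + 2 * derive1 g (mitscherlich beta x))
    (x1 x2 : R) (hx1 : L <= x1) (hx12 : x1 < x2) (hx2 : x2 < U) :
  (forall x3 : R, x2 < x3 <= U ->
     \det (fisher_info g n beta [tuple x1; x2; x3]) =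
     beta 0 1 ^+ 2 *
     ((x1 * x2) `^ beta 0 2 * ln (x2 / x1)
      - (x1 * x3) `^ beta 0 2 * ln (x3 / x1)
      + (x2 * x3) `^ beta 0 2 * ln (x3 / x2)) ^+ 2 *
     \prod_(i < 3) ((n i)%:R *
        derive1 g (mitscherlich beta (tnth [tuple x1; x2; x3] i)))) /\
  argmax [set x3 : R | x2 < x3 <= U]
    (fun x3 => \det (fisher_info g n beta [tuple x1; x2; x3])) = [set U].
Proof.
have x1_ge0 : 0 <= x1 by exact: le_trans hx1.
have x2_gt0 : 0 < x2 by exact: le_lt_trans hx12.
have detE x3 : x2 < x3 -> \det (fisher_info g n beta [tuple x1; x2; x3]) =
     beta 0 1 ^+ 2 *
     ((x1 * x2) `^ beta 0 2 * ln (x2 / x1)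
      - (x1 * x3) `^ beta 0 2 * ln (x3 / x1)
      + (x2 * x3) `^ beta 0 2 * ln (x3 / x2)) ^+ 2 *
     \prod_(i < 3) ((n i)%:R *
        derive1 g (mitscherlich beta (tnth [tuple x1; x2; x3] i))).
  move=> x23.
  have x3_gt0 : 0 < x3 by exact: lt_trans x23.
  rewrite det_fisher_info//; last first.
    move=> i; rewrite (tnth_nth 0); case: i => -[|[|[|//]]] i /=.
    - exact: x1_ge0.
    - exact: ltW.
    - exact: ltW.
  by rewrite !powR_ln_ratio// ltW.
split; first by move=> x3 /andP[/detE].
have inLU x : x1 <= x <= U -> L <= x <= U.
  by move=> /andP[xx ->]; rewrite (le_trans hx1).
have x12 := ltW hx12; have x2U := ltW hx2.
have g'_gt0 x : x1 <= x <= U -> 0 < derive1 g (mitscherlich beta x).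
  move=> /inLU xLU; rewrite lt_def hg1// andbT.
  exact: canonical_link_derive_neq0 hlink (hM _ xLU).
(* The denominator comes from [ln (x `^ beta 0 2) = beta 0 2 * ln x]. *)
pose K := (beta 0 1 / beta 0 2) ^+ 2 *
  ((n 0)%:R * derive1 g (mitscherlich beta x1)) *
  ((n 1)%:R * derive1 g (mitscherlich beta x2)) * (n 2)%:R.
have K_gt0 : 0 < K.
  have n0 i : 0 < (n i)%:R :> R by rewrite ltr0n.
  apply: mulr_gt0 (n0 _); apply: mulr_gt0; last first.
    by apply: mulr_gt0 (n0 _) _; apply: g'_gt0; rewrite x12.
  apply: mulr_gt0; first by rewrite exprn_gt0// divr_gt0.
  by apply: mulr_gt0 (n0 _) _; apply: g'_gt0; rewrite lexx (le_trans x12).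
pose h x := xlnx_det (x1 `^ beta 0 2) (x2 `^ beta 0 2) (x `^ beta 0 2) ^+ 2 *
  derive1 g (mitscherlich beta x).
pose f x3 := \det (fisher_info g n beta [tuple x1; x2; x3]).
rewrite -/f.
have fE x : x2 < x -> f x = K * h x.
  move=> x2x; rewrite /f detE//.
  have x0 : 0 < x by exact: lt_trans x2x.
  rewrite prod_ord3 !(tnth_nth 0) /=.
  rewrite !powR_ln_ratio// ?(ltW x2_gt0)// /K /h /xlnx_det !ln_powR.
  move: (derive1 g _) (derive1 g _) (derive1 g _) (n _)%:R (n _)%:R (n _)%:R.
  move: (x1 `^ _) (x2 `^ _) (x `^ _) (ln _) (ln _) (ln _) => *.
  by field; rewrite gt_eqF.
have hlt x : x2 < x -> x < U -> h x < h U.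
  move=> x2x xU.
  have x1x := le_trans x12 (ltW x2x).
  have inxU z : x <= z <= U -> L <= z <= U.
    by move=> /andP[xz zU]; apply: inLU; rewrite zU (le_trans x1x).
  have [_ [_ _ dg] _ _] := hlink.
  apply: (sqr_xlnx_det_mul_derive1_lt hbeta1 hbeta2 hbeta3 dg) => //.
  - by move=> z /inxU; exact: hM.
  - by move=> z /inxU; exact: hg3.
  - by apply: g'_gt0; rewrite x1x ltW.
  - exact: powR_ge0.
  - by rewrite gt0_ltr_powR ?nnegrE// ltW.
  - by rewrite gt0_ltr_powR ?nnegrE// ltW// (lt_trans x2_gt0).
  - exact: lt_trans x2x.
clearbody f.
apply: (argmax_right_endpoint hx2) => x x2x xU.
by rewrite (fE _ x2x) (fE _ hx2) ltr_pM2l// hlt.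
Qed.
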